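(* Let $Z$ be a finite metric space with metric $d^Z$ and let $X\subseteq Z$ be a nonempty subset. Let $m^{D}((\infty,b))$, for $b>0$, be the multiplicities on the infinity line of the matching diagram of $X\subseteq Z$, and let $\eta_f=\max\{\,b\ge 0\mid b=0\text{ or }(b>0\text{ and }m^{D}((\infty,b))>0)\,\}$. Assume $\eta_f\ne 0$. Let $c_f$ be the maximum number of points of $Z\setminus X$ contained in a single connected component of $\mathrm{VR}_{\eta_f}(Z)$, and put $$b_f=\sup\Big\{b>0 \;\Big|\; \sum_{r\ge b} m^{D}((\infty,r))\ge c_f\Big\},\qquad r_f=\Big(\sum_{b\ge b_f} m^{D}((\infty,b))\Big)-c_f .$$ Then $$d^Z_H(X,Z)\;\le\;\Big(\sum_{b\ge b_f} m^{D}((\infty,b))\,b\Big)-r_f\,b_f,$$ where $d^Z_H$ denotes the Hausdorff distance between subsets of $Z$.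
   Context: For nonempty $A,B\subseteq Z$, $d^Z_H(A,B)=\max\{\max_{a\in A}d^Z(a,B),\max_{b\in B}d^Z(A,b)\}$ where $d^Z(a,B)=\min_{b\in B}d^Z(a,b)$ and $d^Z(A,b)=\min_{a\in A}d^Z(a,b)$. For a finite metric space $M$ with metric $d$ and $r\ge 0$, $\mathrm{VR}_r(M)$ is the graph with vertex set $M$ and an edge between distinct $x,y\in M$ whenever $d(x,y)\le r$; $X$ carries the metric restricted from $Z$. $H_0(\mathrm{VR}_r(M))$ is the $\mathbb{Z}_2$-vector space freely generated by the set $\pi_0(\mathrm{VR}_r(M))$ of connected components. Let $V=\mathrm{PH}_0(X)$ and $U=\mathrm{PH}_0(Z)$ be the persistence modules $V_r=H_0(\mathrm{VR}_r(X))$, $U_r=H_0(\mathrm{VR}_r(Z))$, $r\ge0$, with structure maps $\rho^V_{rs},\rho^U_{rs}$ ($r\le s$) induced by the inclusions of graphs. For $b>0$ let $\kappa_b$ be the interval module of $[0,b)$ and $\kappa_\infty$ that of $[0,\infty)$ over $\mathbb{Z}_2$. There is an isomorphism $U\simeq\big(\bigoplus_{b>0}\kappa_b^{m^U(b)}\big)\oplus\kappa_\infty$, which defines the multiplicities $m^U(b)\in\mathbb{Z}_{\ge0}$ (nonzero for only finitely many $b$). For $b>0$ put $\ker_b^-(U)=\bigcup_{0\le r<b}\ker(\rho^U_{0r})$ and $\ker_b^+(U)=\ker(\rho^U_{0b})$, subspaces of $U_0$; define $\ker_a^\pm(V)\subseteq V_0$ in the same way. Since $X\subseteq Z$, we view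 $V_0\subseteq U_0$. The induced block function is, for $a,b>0$, $$\mathcal{M}_X^Z(a,b)=\dim\left(\frac{\ker_a^+(V)\cap\ker_b^+(U)}{\ker_a^-(V)\cap\ker_b^+(U)+\ker_a^+(V)\cap\ker_b^-(U)}\right).$$ The matching diagram $D=D(X,Z)$ is the multiset of pairs with multiplicities $m^D((a,b))=\mathcal{M}_X^Z(a,b)$ for $a,b\in\mathbb{R}_{>0}$, and $m^D((\infty,b))=m^U(b)-\sum_{a<\infty}\mathcal{M}_X^Z(a,b)$ for $b>0$. *)

(* Defs.v *)
From HB Require Import structures.
From mathcomp Require Import all_boot all_order all_algebra.
From mathcomp Require Import all_classical all_reals all_analysis.

Set Implicit Arguments.
Unset Strict Implicit.
Unset Printing Implicit Defensive.

Import Order.TTheory GRing.Theory Num.Theory.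

Local Open Scope classical_set_scope.
Local Open Scope ring_scope.

#[short(type="finMetricType")]
HB.structure Definition FinMetric (R : numDomainType) :=
  {Z of Finite Z & Metric R Z}.

Section Hausdorff.
Context {R : realType} {Z : finMetricType R}.
Implicit Types A B : {set Z}.

(* [sup] and [inf] below are taken over finite nonempty sets, hence are
   a maximum and a minimum. *)
Definition dist_point_set (z : Z) A : R := inf [set mdist z a | a in [set` A]].

Definition dist_hausdorff A B : R :=
  Num.max (sup [set dist_point_set a B | a in [set` A]])
          (sup [set dist_point_set b A | b in [set` B]]).

End Hausdorff.

(* Only the part of the data at indices [0 <= r <= s] is meaningful: the laws
   below and the notion of isomorphism ignore the remaining spaces and maps. *)
Record persmod (R : realType) (F : fieldType) := PersMod {
  pm_space : R -> vectType F ;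
  pm_map : forall r s : R, 'Hom(pm_space r, pm_space s) ;
  pm_map_id : forall r, 0 <= r -> pm_map r r = \1%VF ;
  pm_map_comp : forall r s t, 0 <= r -> r <= s -> s <= t ->
    (pm_map s t \o pm_map r s)%VF = pm_map r t }.

Lemma lker_pm_map (R : realType) (F : fieldType) (V : persmod R F) (r s t : R) :
  0 <= r -> r <= s -> s <= t ->
  (lker (pm_map V r s) <= lker (pm_map V r t))%VS.
Proof.
move=> r0 rs st; apply/subvP => v; rewrite !memv_ker => /eqP vs.
by rewrite -(pm_map_comp _ r0 rs st) comp_lfunE vs linear0.
Qed.

Definition persmod_iso (R : realType) (F : fieldType) (V W : persmod R F) : Prop :=
  exists f : forall r, 'Hom(pm_space V r, pm_space W r),
    (forall r, 0 <= r -> bijective (f r)) /\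
    (forall r s, 0 <= r -> r <= s ->
      (f s \o pm_map V r s)%VF = (pm_map W r s \o f r)%VF).

Section DirectSum.
Context {R : realType} {F : fieldType}.
Implicit Types V W : persmod R F.

Definition pm_zero : persmod R F.
Proof.
refine (@PersMod R F (fun=> 'rV[F]_0) (fun _ _ => \1%VF) _ _) => //.
by move=> *; rewrite comp_lfun1r.
Defined.

Definition dsum_map V W r s :
    pm_space V r * pm_space W r -> pm_space V s * pm_space W s :=
  fun x => (pm_map V r s x.1, pm_map W r s x.2).

Fact dsum_map_linear V W r s : linear (@dsum_map V W r s).
Proof. by move=> a x y; rewrite /dsum_map !linearP. Qed.

HB.instance Definition _ V W r s :=
  GRing.isLinear.Build F _ _ _ (@dsum_map V W r s) (@dsum_map_linear V W r s).

Definition pm_dsum V W : persmod R F.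
Proof.
refine (@PersMod R F (fun r => (pm_space V r * pm_space W r)%type)
  (fun r s => linfun (@dsum_map V W r s)) _ _).
- move=> r r0; apply/lfunP => -[x y].
  by rewrite lfunE /= /dsum_map !pm_map_id// !lfunE.
- move=> r s t r0 rs st; apply/lfunP => -[x y].
  by rewrite comp_lfunE !lfunE /= /dsum_map /= -!comp_lfunE !pm_map_comp.
Defined.

End DirectSum.

Section IntervalModule.
Context (R : realType) (F : fieldType).

(* The interval module of the half-open interval from [0] to [b], where [b] may
   be [+oo]: at [r] its space is ['rV_1] if [r < b] and ['rV_0] otherwise. *)
Definition interval_map (b : \bar R) (r s : R) :
    'rV[F]_(r%:E < b)%E -> 'rV[F]_(s%:E < b)%E := fun v => v *m const_mx 1.

Fact interval_map_linear b r s : linear (@interval_map b r s).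
Proof. by move=> a x y; rewrite /interval_map mulmxDl scalemxAl. Qed.

HB.instance Definition _ b r s :=
  GRing.isLinear.Build F _ _ _ (@interval_map b r s) (@interval_map_linear b r s).

Definition pm_interval (b : \bar R) : persmod R F.
Proof.
refine (@PersMod R F (fun r => 'rV[F]_(r%:E < b)%E)
  (fun r s => linfun (@interval_map b r s)) _ _).
- move=> r _; apply/lfunP => v; rewrite !lfunE /= /interval_map.
  case: (r%:E < b)%E v => v; last by apply/rowP => -[].
  by apply/rowP => i; rewrite !ord1 !mxE big_ord1 mxE mulr1.
- move=> r s t _ rs st; apply/lfunP => v.
  rewrite comp_lfunE !lfunE /= /interval_map -mulmxA; congr (_ *m _).
  have : ((t%:E < b) ==> (s%:E < b))%E.
    by apply/implyP; apply: le_lt_trans; rewrite lee_fin.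
  case: (t%:E < b)%E; last by move=> _; apply/matrixP => i [].
  move=> /= ->; apply/matrixP => i j.
  by rewrite !mxE big_ord1 !mxE mulr1.
Defined.

End IntervalModule.

(* [U] is isomorphic to the direct sum of [m b] copies of the interval module
   with endpoint [b], for every [b > 0], and of one copy of that with endpoint
   [+oo]; the sequence [s] enumerates the finite support of [m]. The values of
   [m] at [b <= 0] play no role. *)
Definition has_multiplicities (R : realType) (F : fieldType)
    (U : persmod R F) (m : R -> nat) : Prop :=
  exists s : seq R,
    [/\ uniq s,
        forall b, (b \in s) = (0 < b) && (m b != 0%N) &
        persmod_iso U
          (pm_dsum
             (\big[pm_dsum/pm_zero]_(b <- s)
                iter (m b) (pm_dsum (pm_interval F b%:E)) pm_zero)
             (pm_interval F +oo%E))].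

Section Kernels.
Context {R : realType} {F : fieldType}.
Implicit Types (V U : persmod R F) (a b : R).

Definition ker_plus V b : {vspace pm_space V 0} := lker (pm_map V 0 b).

(* The subspace whose underlying set is the union of the kernels of the maps
   from [0] to [r], for [0 <= r < b]; its existence is [ker_minusE] below. *)
Definition ker_minus V b : {vspace pm_space V 0} :=
  xget 0%VS [set W : {vspace pm_space V 0} |
    [set` W] = \bigcup_(r in [set r : R | 0 <= r < b])
                 [set` lker (pm_map V 0 r)] ].

Lemma ker_minusE V b : 0 < b ->
  [set` ker_minus V b] =
  \bigcup_(r in [set r : R | 0 <= r < b]) [set` lker (pm_map V 0 r)].
Proof.
move=> b0.
pose P n := `[< exists2 r : R, 0 <= r < b & \dim (lker (pm_map V 0 r)) = n >].
have exP : exists n, P n.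
  by exists (\dim (lker (pm_map V 0 0))); apply/asboolP; exists 0; rewrite ?lexx.
have ubP n : P n -> (n <= \dim {:pm_space V 0})%N.
  by move=> /asboolP[r _ <-]; exact/dimvS/subvf.
have [n /asboolP[r /andP[r0 rb] <-] nmax] := ex_maxnP exP ubP.
suff : exists W : {vspace pm_space V 0}, [set` W] =
    \bigcup_(r in [set r : R | 0 <= r < b]) [set` lker (pm_map V 0 r)].
  by move=> [W WE]; rewrite /ker_minus; case: xgetP => [W' _ //|/(_ W)].
exists (lker (pm_map V 0 r)); apply/seteqP; split=> [v /= rv|v [s /= /andP[s0 sb]]].
  by exists r => //=; rewrite r0.
have [sr|/ltW rs] := leP s r; first exact/subvP/lker_pm_map.
suff -> : lker (pm_map V 0 r) = lker (pm_map V 0 s) by [].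
apply/eqP; rewrite eqEdim lker_pm_map//= nmax//.
by apply/asboolP; exists s; rewrite ?s0.
Qed.

(* [i] is the inclusion of [V] at [0] into [U] at [0]. When [W <= S], the
   subspace [S :\: W] is a complement of [W] in [S], hence isomorphic to the
   quotient of [S] by [W]. *)
Definition block_function V U (i : 'Hom(pm_space V 0, pm_space U 0)) a b : nat :=
  \dim ((i @: ker_plus V a :&: ker_plus U b) :\:
        (i @: ker_minus V a :&: ker_plus U b + i @: ker_plus V a :&: ker_minus U b)).

End Kernels.

Section VietorisRips.
Context {R : realType} {Z : finMetricType R}.
Implicit Types (M N P : {set Z}) (r s t : R).

Definition VR M r : rel Z :=
  [rel x y | [&& x \in M, y \in M, x != y & mdist x y <= r]].

Definition pi0 M r : {set {set Z}} :=
  equivalence_partition (connect (VR M r)) M.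

Definition pi0_type M r := {C : {set Z} | C \in pi0 M r}.

Definition H0 M r : vectType 'F_2 := {ffun pi0_type M r -> ('F_2)^o}.

(* The map on [H0] induced by an inclusion [VR M r -> VR N s], which sends
   every component to the component that contains it. *)
Definition H0_fun M r N s (v : H0 M r) : H0 N s :=
  [ffun D : pi0_type N s => \sum_(C : pi0_type M r | val C \subset val D) v C].

Fact H0_fun_linear M r N s : linear (@H0_fun M r N s).
Proof.
move=> a u v; apply/ffunP => D; rewrite !ffunE scaler_sumr -big_split /=.
by apply: eq_bigr => C _; rewrite !ffunE.
Qed.

HB.instance Definition _ M r N s :=
  GRing.isLinear.Build 'F_2 _ _ _ (@H0_fun M r N s) (@H0_fun_linear M r N s).

Definition H0_map M r N s : 'Hom(H0 M r, H0 N s) := linfun (@H0_fun M r N s).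


Lemma VR_sub M N r s : M \subset N -> r <= s -> subrel (VR M r) (VR N s).
Proof.
move=> MN rs x y /and4P[xM yM xy d].
by rewrite /VR /= !(fintype.subsetP MN)// xy (le_trans d).
Qed.

Lemma VR_connect_equiv M r :
  {in M & &, equivalence_rel (connect (VR M r))}.
Proof.
have sym : connect_sym (VR M r).
  apply: sym_connect_sym => x y; rewrite /VR /= metric_sym (eq_sym y).
  by rewrite andbCA.
by move=> x y z _ _ _; split => // xy; exact: (same_connect sym).
Qed.

Lemma pi0_partition M r : finset.partition (pi0 M r) M.
Proof. exact/equivalence_partitionP/VR_connect_equiv. Qed.

Lemma pi0_sub M r N s (C : {set Z}) : M \subset N -> r <= s -> C \in pi0 M r ->
  exists2 D, D \in pi0 N s & C \subset D.
Proof.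
move=> MN rs /imsetP[x xM ->].
exists [set y in N | connect (VR N s) x y]; first by apply: imset_f; exact: (fintype.subsetP MN).
apply/fintype.subsetP => y; rewrite !inE => /andP[yM xy].
rewrite (fintype.subsetP MN)//=; apply: connect_sub xy => u v uv.
exact/connect1/(VR_sub MN rs).
Qed.

Lemma pi0_sub_eq M r (C D E : {set Z}) : C != finset.set0 ->
  D \in pi0 M r -> E \in pi0 M r -> C \subset D -> C \subset E -> D = E.
Proof.
move=> /set0Pn[x xC] D0 E0 CD CE.
have /and3P[_ tI _] := pi0_partition M r.
by rewrite -(def_pblock tI D0 (fintype.subsetP CD _ xC)) (def_pblock tI E0 (fintype.subsetP CE _ xC)).
Qed.

Lemma pi0_neq0 M r (C : {set Z}) : C \in pi0 M r -> C != finset.set0.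
Proof.
by have /and3P[_ _ n0] := pi0_partition M r; apply: contraTneq => ->.
Qed.

Lemma H0_map_id M r : H0_map M r M r = \1%VF.
Proof.
apply/lfunP => v; rewrite !lfunE /=; apply/ffunP => D; rewrite ffunE.
rewrite (big_pred1 D)// => C /=; apply/idP/eqP => [CD|->//].
apply/val_inj/(pi0_sub_eq (pi0_neq0 (valP C)) (valP C) (valP D)) => //.
Qed.

Lemma H0_map_comp M r N s P t : M \subset N -> r <= s -> N \subset P -> s <= t ->
  (H0_map N s P t \o H0_map M r N s)%VF = H0_map M r P t.
Proof.
move=> MN rs NP st; apply/lfunP => v; rewrite comp_lfunE !lfunE /=.
apply/ffunP => E; rewrite !ffunE.
under eq_bigr do rewrite ffunE.
rewrite (exchange_big_dep (fun C : pi0_type M r => val C \subset val E)) /=; last first.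
  by move=> D C DE CD; exact: fintype.subset_trans CD DE.
apply: eq_bigr => C CE; have [D DN CD] := pi0_sub MN rs (valP C).
have C0 := pi0_neq0 (valP C).
rewrite (big_pred1 (Sub D DN)) // => D' /=; apply/andP/eqP => [[_ CD']|->].
  by apply/val_inj => /=; exact: (pi0_sub_eq C0 (valP D') DN).
split=> //=; have [E' EP DE'] := pi0_sub NP st DN.
by rewrite (pi0_sub_eq C0 (valP E) EP CE (fintype.subset_trans CD DE')).
Qed.

Definition PH0 M : persmod R 'F_2 :=
  @PersMod R 'F_2 (H0 M) (fun r s => H0_map M r M s)
    (fun r _ => H0_map_id M r)
    (fun r s t _ rs st => H0_map_comp (subxx M) rs (subxx M) st).

End VietorisRips.

Section Matching.
Context {R : realType} {Z : finMetricType R}.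
Implicit Types (X : {set Z}) (a b : R).

Definition induced_block X a b : nat :=
  @block_function R 'F_2 (PH0 X) (PH0 [set: Z]%SET) (H0_map X 0 [set: Z]%SET 0) a b.

(* The multiplicity of [(+oo, b)] in the matching diagram, for [mU] the
   multiplicity function of the persistence module of the whole space. *)
Definition matching_infty X (mU : R -> nat) b : int :=
  (mU b)%:Z - \sum_(a \in [set a : R | 0 < a]) (induced_block X a b)%:Z.

Section Bound.
Context (X : {set Z}) (mU : R -> nat).
Let mD b := matching_infty X mU b.

(* The supremum of a finite nonempty set, hence its maximum. *)
Definition eta_f : R := sup [set b | b = 0 \/ (0 < b /\ 0 < mD b)].

Definition c_f : nat := \max_(C in pi0 [set: Z]%SET eta_f) #|C :\: X|.

Definition b_f : R :=
  sup [set b : R | 0 < b /\ c_f%:Z <= \sum_(r \in [set r : R | b <= r]) mD r].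

Definition r_f : int :=
  \sum_(b \in [set b : R | b_f <= b]) mD b - c_f%:Z.

End Bound.

End Matching.

(* Main.v *)
From HB Require Import structures.
Require Import Defs.
From mathcomp Require Import all_boot all_order all_algebra.
From mathcomp Require Import all_classical all_reals all_analysis.
From mathcomp Require Import zify.

Set Implicit Arguments.
Unset Strict Implicit.
Unset Printing Implicit Defensive.

Import Order.TTheory GRing.Theory Num.Theory.

Local Open Scope classical_set_scope.
Local Open Scope ring_scope.

(* Let [far r] be the number of components of [VR_r(Z)] that do not meet [X].
   The dimensions defining the block function telescope in [a], and the rank of
   [H_0(X) -> H_0(VR_r(Z))] is the number of components that do meet [X]; hence
   [m^D((oo, b))] is the drop of [far] at [b].

   Give each pair of points at distance [d] the weight [(#|Z| + 1)^k], where
   [k] is the number of pairs at distance less than [d], so that a long edge is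
   heavier than any simple path of shorter edges. On a lightest path from [z]
   to [X], the edges longer than [r] start in distinct components of
   [VR_r(Z)] that do not meet [X], so there are at most [far r] of them. As
   [far eta_f = 0], the whole path lies in one component of [VR_{eta_f}(Z)],
   so it has at most [c_f] edges. Its length, which bounds [d(z, X)], is the
   integral over [r] of the number of edges longer than [r]; this is at most
   the integral of [min(c_f, far r)], the claimed bound. *)

(** * Kernel dimensions of persistence modules and interval multiplicities *)

Definition ker_dim {R : realType} {F : fieldType} (V : persmod R F) (r : R) : nat :=
  \dim (ker_plus V r).

Section KernelDimension.
Context {R : realType} {F : fieldType}.
Implicit Types (V W : persmod R F) (r b : R).

Lemma ker_dim_iso V W r : 0 <= r -> persmod_iso V W -> ker_dim V r = ker_dim W r.
Proof.
move=> r0 [f [fbij fnat]].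
have inj s : 0 <= s -> lker (f s) == 0%VS.
  by move=> s0; apply/lker0P; exact/bij_inj/fbij.
have ker0 : lker (f 0) == 0%VS by exact: inj.
rewrite /ker_dim /ker_plus; set K := lker (pm_map V 0 r).
rewrite -(@limg_dim_eq _ _ _ (f 0) K); last by rewrite (eqP ker0) capv0.
congr (\dim _); apply/vspaceP => w; rewrite memv_ker.
have natE v : f r (pm_map V 0 r v) = pm_map W 0 r (f 0 v).
  by have /lfunP/(_ v) := fnat _ _ (lexx 0) r0; rewrite !comp_lfunE.
apply/memv_imgP/idP => [[v vK ->]|].
  by rewrite -natE; move: vK; rewrite memv_ker => /eqP ->; rewrite linear0.
have [g _ gK] := fbij _ (lexx 0).
rewrite -{1}(gK w) -natE => fv0; exists (g w); last by rewrite gK.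
rewrite memv_ker; apply/eqP/(bij_inj (fbij _ r0)); rewrite linear0.
exact/eqP.
Qed.

Lemma ker_dim_zero r : ker_dim (@pm_zero R F) r = 0%N.
Proof.
apply/eqP; rewrite -leqn0 /ker_dim /ker_plus (leq_trans (dimvS (subvf _)))//.
by rewrite dimvf dim_matrix.
Qed.

(** The coordinate injections embed both kernels with images that meet in zero and span the kernel
    of the sum. *)
Lemma ker_dim_dsum V W r : ker_dim (pm_dsum V W) r = (ker_dim V r + ker_dim W r)%N.
Proof.
rewrite /ker_dim /ker_plus /=.
pose A := pm_space V 0; pose B := pm_space W 0.
pose il (x : A) : (A * B)%type := (x, 0).
pose ir (y : B) : (A * B)%type := (0, y).
have il_lin : linear il by move=> a x y; congr pair; rewrite /= ?scaler0 ?addr0.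
have ir_lin : linear ir by move=> a x y; congr pair; rewrite /= ?scaler0 ?addr0.
pose ilL := GRing.isLinear.Build F _ _ _ il il_lin.
pose irL := GRing.isLinear.Build F _ _ _ ir ir_lin.
pose il' : {linear A -> (A * B)%type} := HB.pack il ilL.
pose ir' : {linear B -> (A * B)%type} := HB.pack ir irL.
have ilE x : linfun il' x = (x, 0) by rewrite lfunE.
have irE x : linfun ir' x = (0, x) by rewrite lfunE.
have kl : lker (linfun il') == 0%VS.
  by apply/lker0P => x y; rewrite !ilE => -[].
have kr : lker (linfun ir') == 0%VS.
  by apply/lker0P => x y; rewrite !irE => -[].
set KV := lker (pm_map V 0 r); set KW := lker (pm_map W 0 r).
rewrite -(@limg_dim_eq _ _ _ (linfun il') KV); last by rewrite (eqP kl) capv0.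
rewrite -(@limg_dim_eq _ _ _ (linfun ir') KW); last by rewrite (eqP kr) capv0.
rewrite -dimv_disjoint_sum; last first.
  apply/eqP; rewrite -subv0; apply/subvP => _ /memv_capP[/memv_imgP[x _ ->]].
  by move=> /memv_imgP[y _]; rewrite ilE irE => -[-> _]; rewrite memv0.
congr (\dim _); apply/vspaceP => -[x y]; rewrite memv_ker lfunE /=.
apply/idP/idP => [/eqP[x0 y0]|].
  have -> : (x, y) = linfun il' x + linfun ir' y.
    by rewrite ilE irE; congr pair; rewrite /= ?add0r ?addr0.
  by apply/memv_add; apply/memv_img; rewrite memv_ker ?x0 ?y0.
move=> /memv_addP[_ /memv_imgP[x' x'K ->] [_ /memv_imgP[y' y'K ->]]].
move: x'K y'K; rewrite ilE irE !memv_ker => /eqP x0 /eqP y0.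
by move=> [-> ->]; rewrite /dsum_map /= addr0 add0r x0 y0.
Qed.

Lemma ker_dim_interval (b : \bar R) r : (0%:E < b)%E ->
  ker_dim (pm_interval F b) r = ~~ (r%:E < b)%E.
Proof.
move=> b0; have /orP[rb|nrb] := orbN (r%:E < b)%E; last first.
  rewrite nrb /ker_dim /ker_plus /=.
  suff -> : lker (linfun (@interval_map R F b 0 r)) = fullv.
    by rewrite dimvf dim_matrix b0.
  apply/vspaceP => v; rewrite memvf memv_ker lfunE /=.
  rewrite /interval_map; apply/eqP/rowP => -[j jr]; move: (jr).
  by rewrite (negbTE nrb).
rewrite rb /ker_dim /ker_plus /=.
suff /eqP -> : lker (linfun (@interval_map R F b 0 r)) == 0%VS by rewrite dimv0.
(* While the interval is alive, the transition is multiplication by the [1 x 1] matrix with entry 1.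
   Generalizing both sizes to booleans permits a case analysis despite the dependent matrix
   types. *)
have const1 (p q : bool) : p -> q ->
    (const_mx 1 : 'M[F]_(p, q)) *m (const_mx 1 : 'M[F]_(q, p)) = 1%:M.
  case: p q => -[] // _ _; apply/matrixP => i j.
  by rewrite !mxE big_ord1 !mxE !ord1 mulr1.
apply/lker0P => v w; rewrite !lfunE /= /interval_map => vw.
by rewrite -[v]mulmx1 -[w]mulmx1 -(const1 _ _ b0 rb) !mulmxA vw.
Qed.

(** Kernel dimensions are additive and invariant under isomorphism. The interval ending at [b]
    contributes one dimension once [b <= r], and the infinite interval contributes none. *)
Lemma ker_dim_multiplicities V (m : R -> nat) : has_multiplicities V m ->
  exists s : seq R, [/\ uniq s, forall b, (b \in s) = (0 < b) && (m b != 0%N) &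
    forall r, 0 <= r -> ker_dim V r = \sum_(b <- s | (b <= r)%R) m b].
Proof.
move=> [s [us sE iso]]; exists s; split=> // r r0.
rewrite (ker_dim_iso r0 iso) ker_dim_dsum ker_dim_interval ?ltry// addn0.
have : all (> 0) s by apply/allP => b; rewrite sE => /andP[].
elim: s {us sE iso} => [|b s IH] /=; first by rewrite !big_nil ker_dim_zero.
move=> /andP[b0 /IH{}IH]; rewrite !big_cons ker_dim_dsum IH.
suff -> : ker_dim (iter (m b) (pm_dsum (pm_interval F b%:E)) pm_zero) r =
          (if (b <= r)%R then m b else 0)%N by case: ifP.
elim: (m b) => [|n IHn] /=; first by rewrite ker_dim_zero if_same.
rewrite ker_dim_dsum IHn ker_dim_interval ?lte_fin// -leNgt.
by case: ifP.
Qed.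

End KernelDimension.

(** * Comparing sums by counting entries above each level *)

Section SequenceComparison.
Context {R : realType}.
Implicit Types (s t : seq R).

Lemma mem_maxr s : (0 < size s)%N ->
  exists2 m, m \in s & all (fun x => x <= m) s.
Proof.
elim: s => // a [|b s] IH _; first by exists a; rewrite ?mem_head //= lexx.
have [//|m ms mub] := IH.
have [am|/ltW ma] := leP a m.
  by exists m; [rewrite inE ms orbT|exact/andP].
exists a; first exact: mem_head.
apply/allP => x; rewrite inE => /predU1P[-> //|/(allP mub) xm].
exact: le_trans ma.
Qed.

(** A sum of nonnegative reals is the integral over [r] of the number of entries above [r]. The
    proof stays discrete: the largest entry of [s] is at most that of [t], and deleting both
    preserves the hypothesis. *)
Lemma ler_sum_count s t : all (>= 0) s -> all (>= 0) t ->
  (forall r, 0 <= r -> (count (> r)%R s <= count (> r)%R t)%N) ->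
  \sum_(x <- s) x <= \sum_(x <- t) x.
Proof.
have [n] := ubnP (size s); elim: n s t => // n IH s t sn s0 t0 st.
have [s_gt0|] := boolP (has (> 0) s); last first.
  rewrite -all_predC => /allP s_le0.
  rewrite big1_seq; first by rewrite big_seq sumr_ge0// => x /(allP t0).
  move=> x /andP[_ xs]; apply/eqP; rewrite eq_le (allP s0)// andbT.
  by have := s_le0 _ xs; rewrite /= -leNgt.
have sz_t : (0 < size t)%N.
  apply: leq_trans (count_size (> 0) t); apply: leq_trans (st 0 (lexx _)).
  by rewrite -has_count.
have sz_s : (0 < size s)%N.
  by apply: leq_trans (count_size (> 0) s); rewrite -has_count.
have [a as_ /allP aub] := mem_maxr sz_s; have [b bt /allP bub] := mem_maxr sz_t.
have ab : a <= b.
  rewrite leNgt; apply/negP => ba.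
  have := st b (allP t0 _ bt); rewrite leqNgt => /negP; apply.
  rewrite [X in (X < _)%N](_ : _ = 0%N); last first.
    apply/eqP; rewrite eqn0Ngt -has_count; apply/hasPn => x xt.
    by rewrite -leNgt; exact: bub.
  by rewrite -has_count; apply/hasP; exists a.
rewrite [leLHS](big_rem a)//= [leRHS](big_rem b)//= lerD//; apply: IH.
- by rewrite size_rem// -ltnS prednK.
- by apply/allP => x /mem_rem; exact: (allP s0).
- by apply/allP => x /mem_rem; exact: (allP t0).
move=> r r0; have := st r r0.
rewrite (permP (perm_to_rem as_)) (permP (perm_to_rem bt)) /=.
(* Below [a] both counts drop by one; from [a] on, no entry of [s] is counted. *)
have [ra|ar] := ltP r a; first by rewrite (lt_le_trans ra ab) leq_add2l.
move=> _; rewrite [X in (X <= _)%N](_ : _ = 0%N)//.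
apply/eqP; rewrite eqn0Ngt -has_count; apply/hasPn => x /mem_rem xs.
by rewrite -leNgt (le_trans (aub _ xs)).
Qed.

End SequenceComparison.

(** * Step functions with finitely many jumps *)

Section StepFunctions.
Context {R : realType}.
Implicit Types (S : seq R) (r b : R).

(** A step function with jumps in [S] is constant from here up to [b] exclusively, so its value here
    is its left limit at [b]. The default 0 is the start of the domain. *)
Definition prev_jump S b : R := \big[Num.max/0]_(x <- S | x < b) x.

Lemma prev_jump_ge0 S b : 0 <= prev_jump S b.
Proof. by exact: bigmax_ge_id. Qed.

Lemma prev_jump_lt S b : 0 < b -> prev_jump S b < b.
Proof.
move=> b0; apply: (big_ind (fun x => x < b)) => // x y xb yb.
by rewrite gt_max xb.
Qed.

Lemma prev_jump_ub S b x : x \in S -> x < b -> x <= prev_jump S b.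
Proof. by move=> xS xb; rewrite /prev_jump; exact: le_bigmax_seq. Qed.

(** Only jumps in the half-open interval from [r] (excluded) to [s] (included) matter: such
    functions are right-continuous, as [VR] gains an edge at its very length. *)
Definition step_on (T : Type) S (h : R -> T) :=
  forall r s, 0 <= r -> r <= s -> (forall x, x \in S -> x <= s -> x <= r) -> h r = h s.

Lemma step_prev_jump (T : Type) S (h : R -> T) b :
  step_on S h -> 0 < b -> b \notin S -> h (prev_jump S b) = h b.
Proof.
move=> hS b0 bS; apply: hS; rewrite ?prev_jump_ge0 ?ltW ?prev_jump_lt//.
move=> x xS; rewrite le_eqVlt => /predU1P[xb|]; last exact: prev_jump_ub.
by rewrite -xb xS in bS.
Qed.

(** Induction on the number of jumps up to [r]: with [a] the last of them, [h r = h a], and the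
    remaining jumps are those up to [prev_jump S a]. *)
Lemma telescope_step (G : zmodType) S (h : R -> G) r : uniq S -> all (> 0) S ->
  step_on S h -> 0 <= r ->
  \sum_(b <- S | b <= r) (h b - h (prev_jump S b)) = h r - h 0.
Proof.
move=> uS S0 hS; have [n] := ubnP (count (<= r) S).
elim: n r => // n IH r cn r0.
have [|] := boolP (has (<= r) S); last first.
  move=> /hasPn Sr; rewrite big1_seq; last first.
    by move=> x /andP[xr xS]; have := Sr _ xS; rewrite /= xr.
  by rewrite (hS 0 r) ?subrr// => x xS; have /= /negbTE -> := Sr _ xS.
rewrite has_count -size_filter => /mem_maxr[a].
rewrite mem_filter /= => /andP[ar aS] /allP aub.
have a0 : 0 < a by exact: (allP S0).
have hra : h a = h r.
  apply: hS => //; first exact: ltW.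
  by move=> x xS xr; apply: aub; rewrite mem_filter /= xr.
have low x : x \in S -> (x <= prev_jump S a) = (x <= r) && (x != a).
  move=> xS; apply/idP/idP => [xp|/andP[xr xa]].
    have xa : x < a := le_lt_trans xp (prev_jump_lt S a0).
    by rewrite (le_trans (ltW xa)) ?(lt_eqF xa).
  apply: prev_jump_ub => //; rewrite lt_neqAle xa /=.
  by apply: aub; rewrite mem_filter /= xr.
have -> : h r - h 0 = (h a - h (prev_jump S a)) + (h (prev_jump S a) - h 0).
  by rewrite hra addrA subrK.
rewrite -IH ?prev_jump_ge0//; last first.
  apply: leq_trans (ltnSE cn).
  have -> : count (<= r) S = size (a :: [seq x <- S | x <= prev_jump S a]).
    rewrite -size_filter; apply/perm_size.
    rewrite uniq_perm ?filter_uniq//= ?mem_filter ?filter_uniq//.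
      by rewrite low// eqxx andbF.
    move=> x; rewrite inE !mem_filter.
    have [->|xa] := eqVneq x a; first by rewrite /= ar aS.
    by have [xS|] := boolP (x \in S); rewrite ?andbF ?andbT//= low// xa andbT.
  by rewrite /= size_filter.
rewrite big_mkcond (bigD1_seq a)//= ar -big_mkcondr.
congr (_ + _); rewrite big_seq_cond [RHS]big_seq_cond; apply: eq_bigl => x.
by have [xS|] := boolP (x \in S) => //=; rewrite low// andbC.
Qed.

End StepFunctions.

(** * Cheapest paths from a point to the subset *)

Section CheapPaths.
Context {R : realType} {Z : finMetricType R}.
Implicit Types (X : {set Z}) (r : R) (z u v y : Z) (p : seq Z).

Local Notation VRZ := (VR [set: Z]%SET).

Lemma VR_connect_sym r u v : connect (VRZ r) u v = connect (VRZ r) v u.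
Proof.
apply: sym_connect_sym => x y.
by rewrite /VR /= metric_sym (eq_sym y) !finset.in_setT.
Qed.

Definition component r z : {set Z} := [set y | connect (VRZ r) z y]%SET.

Lemma component_pi0 r z : component r z \in pi0 [set: Z]%SET r.
Proof.
apply/imsetP; exists z; rewrite ?finset.in_setT//.
by apply/setP => y; rewrite !finset.inE.
Qed.

Lemma eq_component r u v : component r u = component r v -> connect (VRZ r) u v.
Proof.
move=> uv; have : v \in component r v by rewrite finset.inE connect0.
by rewrite -uv finset.inE.
Qed.

Definition far_components X r : {set {set Z}} :=
  [set C in pi0 [set: Z]%SET r | [disjoint C & X]]%SET.

Definition edge_weight u v : nat :=
  (#|Z|.+1 ^ #|[set e : Z * Z | (mdist e.1 e.2 < mdist u v)%R]%SET|)%N.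

Definition cost z p : nat := sumn (pairmap edge_weight z p).

Lemma cost_cat z p p' : cost z (p ++ p') = (cost z p + cost (last z p) p')%N.
Proof. by rewrite /cost pairmap_cat sumn_cat. Qed.

Lemma edge_weight_gt0 u v : (0 < edge_weight u v)%N.
Proof. by rewrite expn_gt0. Qed.

(** Lengthening an edge raises the exponent, since [(u, v)] itself becomes one of the shorter
    pairs. *)
Lemma edge_weight_lt u v u' v' : mdist u v < mdist u' v' ->
  (#|Z|.+1 * edge_weight u v <= edge_weight u' v')%N.
Proof.
move=> lt_d; rewrite -expnS leq_exp2l; last first.
  by rewrite ltnS; apply/card_gt0P; exists u.
apply: proper_card; apply/properP; split.
  by apply/fintype.subsetP => e; rewrite !finset.inE => /lt_trans; exact.
by exists (u, v); rewrite !finset.inE //= ltxx.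
Qed.

(** A simple path has fewer than [#|Z|.+1] edges, and each edge of length at most [r] is lighter
    than [(z, y)] by at least that factor. *)
Lemma cheap_detour r u v z y : connect (VRZ r) u v -> r < mdist z y ->
  exists2 p, last u p = v & (cost u p < edge_weight z y)%N.
Proof.
move=> /connectP[p0 /shortenP[p path_p uniq_p _] ->] rzy {p0 v}.
exists p => //; have cost_size : (#|Z|.+1 * cost u p <= size p * edge_weight z y)%N.
  elim: p u path_p {uniq_p} => [|x p IH] u /=; first by rewrite muln0.
  case/andP => /and4P[_ _ _ ux] /IH xp; rewrite mulnDr mulSn leq_add//.
  exact/edge_weight_lt/(le_lt_trans ux).
have sz_p : (size p < #|Z|.+1)%N.
  rewrite ltnW// ltnS -[X in (X <= _)%N]/(size (u :: p)).
  by rewrite -(card_uniqP uniq_p) max_card.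
rewrite -(ltn_pmul2l (ltn0Sn #|Z|)); apply: (leq_ltn_trans cost_size).
by rewrite ltn_pmul2r ?edge_weight_gt0.
Qed.

(** Paths run in the complete graph on [Z], so every sequence [p] is a candidate. *)
Definition cheapest X z p :=
  last z p \in X /\ forall p', last z p' \in X -> (cost z p <= cost z p')%N.

Lemma exists_cheapest X z : X != finset.set0 -> exists p, cheapest X z p.
Proof.
move=> /set0Pn[x xX].
pose P n := `[< exists2 p, last z p \in X & cost z p = n >].
have exP : exists n, P n by exists (cost z [:: x]); apply/asboolP; exists [:: x].
have [_ /asboolP[p pX <-] pmin] := ex_minnP exP.
by exists p; split=> // p' p'X; apply: pmin; apply/asboolP; exists p'.
Qed.

Lemma cheapest_behead X z y p : cheapest X z (y :: p) -> cheapest X y p.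
Proof.
move=> [pX pmin]; split=> // p' p'X.
by have := pmin (y :: p') p'X; rewrite /cost /= leq_add2l.
Qed.

(* A detour through short edges would be cheaper than the long edge [(z, y)]. *)
Lemma cheapest_separated X z y p r v : cheapest X z (y :: p) ->
  r < mdist z y -> connect (VRZ r) z v -> v \notin X /\ v \notin y :: p.
Proof.
move=> [pX pmin] rzy zv; have [q qv cost_q] := cheap_detour zv rzy.
split; apply/negP.
  rewrite -qv => /pmin; rewrite leqNgt => /negP; apply.
  by apply: (leq_trans cost_q); rewrite /cost /= leq_addr.
move=> vp; case/path.splitPl: vp pX pmin => p1 p2 def_v pX pmin.
have q_X : last z (q ++ p2) \in X.
  by rewrite last_cat qv -def_v -last_cat.
have := pmin _ q_X; rewrite -cat_cons !cost_cat /= qv def_v.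
rewrite leq_add2r leqNgt => /negP; apply.
by rewrite (leq_trans cost_q)// /cost /= leq_addr.
Qed.

Lemma cheapest_source X z y p : cheapest X z (y :: p) ->
  z \notin X /\ z \notin y :: p.
Proof.
move=> opt; apply: (cheapest_separated (r := -1) opt) => //.
exact: lt_le_trans (mdist_ge0 _ _).
Qed.

Lemma cheapest_long_edges X z p r : cheapest X z p ->
  (count (> r)%R (pairmap mdist z p) <= #|far_components X r|)%N.
Proof.
move=> opt.
(* [s] collects the components of the starting points of the long edges. The last clause keeps [s]
   duplicate-free in the induction: by [cheapest_separated], the component of [z] contains no later
   vertex. *)
suff [s [us <- sfar _]] : exists s : seq {set Z},
    [/\ uniq s, size s = count (> r) (pairmap mdist z p),
        {subset s <= far_components X r} &
        forall C, C \in s -> exists2 u, u \in z :: p & C = component r u].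
  rewrite -(card_uniqP us); apply: subset_leq_card.
  by apply/fintype.subsetP => C /sfar.
elim: p z opt => [|y p IH] z opt; first by exists [::].
have [s [us szs sfar scomp]] := IH y (cheapest_behead opt).
have [rzy|zyr] := ltP r (mdist z y); last first.
  exists s; split=> //=; first by rewrite ltNge zyr.
  by move=> C /scomp[u up ->]; exists u; rewrite // finset.inE up orbT.
exists (component r z :: s); split=> /=.
- rewrite us andbT; apply/negP => /scomp[u up /eq_component zu].
  by have [_ /negP[]] := cheapest_separated opt rzy zu.
- by rewrite szs rzy.
- move=> C; rewrite finset.inE => /predU1P[-> {C}|/sfar //].
  rewrite finset.inE component_pi0 /=; apply/pred0P => v /=; rewrite finset.inE.
  by apply/andP => -[/(cheapest_separated opt rzy)[/negP vX _] /vX].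
- move=> C; rewrite finset.inE => /predU1P[->|/scomp[u up ->]].
    by exists z; rewrite ?mem_head.
  by exists u; rewrite // finset.inE up orbT.
Qed.

Lemma short_path_connect z p r u :
  all (<= r) (pairmap mdist z p) -> u \in z :: p -> connect (VRZ r) z u.
Proof.
elim: p z => [|y p IH] z /=; first by rewrite finset.inE => _ /eqP ->.
move=> /andP[zy yp]; rewrite finset.inE => /predU1P[->//|/(IH _ yp)].
apply: connect_trans; have [->//|neq_zy] := eqVneq z y.
by apply: connect1; rewrite /VR /= !finset.in_setT neq_zy.
Qed.

Lemma cheapest_size X z p r : cheapest X z p ->
  far_components X r = finset.set0 ->
  (size p <= \max_(C in pi0 [set: Z]%SET r) #|C :\: X|)%N.
Proof.
move=> opt far0; apply: (@leq_trans #|component r z :\: X|%N); last first.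
  exact: (leq_bigmax_cond (F := fun C : {set Z} => #|C :\: X|%N) _ (component_pi0 r z)).
have short : all (<= r) (pairmap mdist z p).
  have := cheapest_long_edges r opt; rewrite far0 finset.cards0 leqn0.
  rewrite eqn0Ngt -has_count -all_predC; apply: sub_all => d /=.
  by rewrite -leNgt.
(* There is one starting vertex per edge; these are distinct and outside [X], so counting them in
   the component of [z] bounds the number of edges. *)
have [u_src src_X] : uniq (belast z p) /\ {in belast z p, forall u, u \notin X}.
  elim: p z opt {short} => [|y p IH] z opt //=.
  have [zX zp] := cheapest_source opt.
  have [u_p p_X] := IH _ (cheapest_behead opt); split.
    rewrite u_p andbT; apply: contra zp => /mem_belast //.
  by move=> u; rewrite finset.inE => /predU1P[->|/p_X].
rewrite -(size_belast z p) -(card_uniqP u_src); apply/subset_leq_card.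
apply/fintype.subsetP => u up; rewrite !finset.inE (src_X _ up) /=.
exact/(short_path_connect short)/mem_belast.
Qed.

Lemma mdist_path z p : mdist z (last z p) <= \sum_(d <- pairmap mdist z p) d.
Proof.
elim: p z => [|y p IH] z /=; first by rewrite big_nil mdistxx.
by rewrite big_cons (le_trans (metric_triangle z y _))// lerD2l.
Qed.

End CheapPaths.

(** * Rank of the maps induced on connected components *)

Section Pushforward.
Context {F : fieldType} {I J : finType} (p : I -> J).
Variable f : 'Hom({ffun I -> F^o}, {ffun J -> F^o}).
Hypothesis fE : forall (v : {ffun I -> F^o}) j, f v j = \sum_(i | p i == j) v i.

Let delta (K : finType) (k : K) : {ffun K -> F^o} := [ffun k' => (k' == k)%:R].

Let delta_span (K : finType) : <<map (@delta K) (enum K)>>%VS = fullv.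
Proof.
apply/vspaceP => v; rewrite memvf.
have -> : v = \sum_(k <- enum K) v k *: delta k.
  apply/ffunP => k; rewrite sum_ffunE big_enum /= (bigD1 k)//= !ffunE eqxx.
  rewrite [_ *: _]mulr1 big1 ?addr0// => k' kk'.
  by rewrite !ffunE eq_sym (negbTE kk') [_ *: _]mulr0.
rewrite big_seq memv_suml// => k kK.
by rewrite memvZ// memv_span// map_f.
Qed.

Let delta_free (s : seq J) : uniq s -> free (map (@delta J) s).
Proof.
move=> us; have : free (map (@delta J) (enum J)).
  apply: (@basis_free _ _ fullv); rewrite basisEdim delta_span subvv /=.
  by rewrite size_map -cardE dimvf /= /dim /= muln1.
(* Complete [s] by the other elements of [J] to a permutation of the full basis. *)
rewrite (perm_free (Y := map (@delta J) (s ++ seq.filter [predC s] (enum J)))).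
  by rewrite map_cat => /catl_free.
apply/perm_map/uniq_perm => [||k]; rewrite ?enum_uniq//.
  rewrite cat_uniq us filter_uniq ?enum_uniq// andbT.
  by apply/hasPn => k; rewrite mem_filter => /andP[].
by rewrite mem_cat mem_filter /= mem_enum andbT orbN.
Qed.

(** The map sends the basis vector of [i] to that of [p i], so its image is spanned by distinct
    basis vectors, indexed by the image of [p]. *)
Lemma dim_limg_pushforward : \dim (limg f) = #|[set p i | i : I]%SET|.
Proof.
have f_delta i : f (delta i) = delta (p i).
  apply/ffunP => j; rewrite fE !ffunE; under eq_bigr do rewrite ffunE.
  have [->|pij] := eqVneq j (p i).
    by rewrite (bigD1 i)//= eqxx big1 ?addr0// => k /andP[_ /negbTE ->].
  by rewrite big1// => k /eqP pk; case: eqVneq => // ki; rewrite -pk ki eqxx in pij.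
rewrite -delta_span limg_span -map_comp.
rewrite (@eq_span _ _ _ (map (@delta J) (enum [set p i | i : I]%SET))).
  by rewrite (eqP (delta_free (enum_uniq _))) size_map -cardE.
move=> v; apply/mapP/mapP => [[i _ ->]|[j]].
  by exists (p i); rewrite /= ?f_delta // mem_enum imset_f.
rewrite mem_enum => /imsetP[i _ ->] ->; exists i; rewrite ?mem_enum//=.
Qed.

End Pushforward.

Section ComponentRank.
Context {R : realType} {Z : finMetricType R}.
Implicit Types (M N : {set Z}) (r s : R).

(** Each component of the smaller graph lies in a unique component of the larger one, so the map is
    a pushforward; the components hit are those that meet [M]. *)
Lemma rank_H0_map M r N s : M \subset N -> r <= s ->
  \dim (limg (H0_map M r N s)) = #|[set D in pi0 N s | ~~ [disjoint D & M]]%SET|.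
Proof.
move=> MN rs.
have hull (C : pi0_type M r) : {D : pi0_type N s | val C \subset val D}.
  apply/cid; have [D DN CD] := pi0_sub MN rs (valP C).
  by exists (Sub D DN).
pose p C := sval (hull C).
have pP (C : pi0_type M r) : val C \subset val (p C) := svalP (hull C).
have C0 (C : pi0_type M r) := pi0_neq0 (valP C).
have pE (C : pi0_type M r) (D : pi0_type N s) : (val C \subset val D) = (p C == D).
  apply/idP/eqP => [CD|<- //]; apply/val_inj.
  exact: (pi0_sub_eq (C0 C) (valP (p C)) (valP D) (pP C) CD).
rewrite (@dim_limg_pushforward _ _ _ p); last first.
  by move=> v D; rewrite lfunE /= ffunE; apply: eq_bigl => C; rewrite pE.
rewrite -(card_imset _ val_inj); congr #|pred_of_set _|; apply/setP => D.
rewrite finset.inE; apply/imsetP/andP => [[_ /imsetP[C _ ->] ->]|[DN]].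
  split; first exact: (valP (p C)).
  have /set0Pn[x xC] := C0 C; apply/pred0Pn; exists x => /=.
  rewrite (fintype.subsetP (pP C))//=.
  have /and3P[/eqP <- _ _] := pi0_partition M r.
  by apply/bigcupP; exists (val C) => //; exact: valP.
case/pred0Pn => x /= /andP[xD xM].
have /and3P[/eqP covM tM _] := pi0_partition M r.
have xcov : x \in finset.cover (pi0 M r) by rewrite covM.
pose C : pi0_type M r := Sub (finset.pblock (pi0 M r) x) (finset.pblock_mem xcov).
exists (p C); first exact: imset_f.
have /and3P[_ tN _] := pi0_partition N s.
rewrite -(finset.def_pblock tN DN xD) (finset.def_pblock tN (valP (p C)))//.
by rewrite (fintype.subsetP (pP C))//= finset.mem_pblock.
Qed.

End ComponentRank.

(** * Multiplicities and block functions as differences at jumps *)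

Section BlockFunction.
Context {R : realType} {F : fieldType}.
Implicit Types (V U : persmod R F) (S : seq R) (r s a b : R).

Lemma ker_plus0 V : ker_plus V 0 = 0%VS.
Proof.
by apply/eqP/lker0P; rewrite pm_map_id// => v w; rewrite !lfunE.
Qed.

Lemma ker_plusS V r s : 0 <= r -> r <= s -> (ker_plus V r <= ker_plus V s)%VS.
Proof. by move=> r0 rs; apply: lker_pm_map. Qed.

(** The kernels increase with the radius and are constant from the previous jump up to [b], so their
    union is attained there. *)
Lemma ker_minus_prev_jump V S b : step_on S (ker_plus V) -> 0 < b ->
  ker_minus V b = ker_plus V (prev_jump S b).
Proof.
move=> stV b0; apply/vspaceP => v; apply/idP/idP.
  have : [set` ker_minus V b] v -> v \in ker_plus V (prev_jump S b).
    rewrite ker_minusE// => -[r /= /andP[r0 rb]].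
    have [rp|pr] := leP r (prev_jump S b); first exact/subvP/lker_pm_map.
    rewrite -[lker _]/(ker_plus V r) -(stV (prev_jump S b) r)//.
    - exact: prev_jump_ge0.
    - exact: ltW.
    - by move=> x xS xr; apply: prev_jump_ub => //; exact: le_lt_trans rb.
  exact.
suff : v \in ker_plus V (prev_jump S b) -> [set` ker_minus V b] v by [].
move=> vp; rewrite ker_minusE//; exists (prev_jump S b) => //=.
by rewrite prev_jump_ge0 prev_jump_lt.
Qed.

(** The difference of kernel dimensions sums [m] over its support between the previous jump and [b].
    The support lies in [S], because the kernel grows at each of its points, so only [b] itself can
    contribute. *)
Lemma multiplicity_jump V S (m : R -> nat) b : has_multiplicities V m ->
  step_on S (ker_plus V) -> 0 < b ->
  (m b)%:Z = (ker_dim V b)%:Z - (ker_dim V (prev_jump S b))%:Z.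
Proof.
move=> /ker_dim_multiplicities[s [us sE dimE]] stV b0.
have jumpE x : 0 < x -> (\sum_(y <- s | (y <= x)%R) m y =
    \sum_(y <- s | (y <= prev_jump S x)%R) m y +
    \sum_(y <- s | (y <= x)%R && ~~ (y <= prev_jump S x)%R) m y)%N.
  move=> x0; rewrite (bigID (fun y => (y <= prev_jump S x)%R)) /=; congr addn.
  apply: eq_bigl => y; apply: andb_idl => /le_trans; apply.
  exact/ltW/prev_jump_lt.
have sS x : x \in s -> x \in S.
  move=> xs; apply/negPn/negP => xS.
  have /andP[x0 mx0] : (0 < x) && (m x != 0%N) by rewrite -sE.
  have /eqP : ker_dim V x = ker_dim V (prev_jump S x).
    by rewrite /ker_dim (step_prev_jump stV).
  rewrite !dimE ?prev_jump_ge0 ?(ltW x0)// jumpE// -[X in _ == X]addn0 eqn_add2l.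
  rewrite big_mkcond (bigD1_seq x)//= lexx -ltNge prev_jump_lt//.
  by rewrite addn_eq0 (negbTE mx0).
rewrite !dimE ?prev_jump_ge0 ?(ltW b0)// jumpE// PoszD addrAC subrr add0r.
congr Posz; have last_jump y : y \in s -> y <= b -> ~~ (y <= prev_jump S b) -> y = b.
  move=> /sS yS; rewrite le_eqVlt => /predU1P[//|yb] /negP[].
  exact: prev_jump_ub.
have [bs|bs] := boolP (b \in s).
  rewrite big_mkcond (bigD1_seq b)//= lexx -ltNge prev_jump_lt//=.
  rewrite big1_seq ?addn0// => y /andP[/eqP yb ys].
  by case: ifP => // /andP[yb' /(last_jump _ ys yb')].
have -> : m b = 0%N by move: bs; rewrite sE b0 /= negbK => /eqP.
rewrite big1_seq// => y /andP[/andP[yb yp] ys].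
by rewrite -(last_jump _ ys yb yp) ys in bs.
Qed.

Section Telescoping.
Context {V U : persmod R F} (i : 'Hom(pm_space V 0, pm_space U 0)) (S : seq R).
Hypotheses (stV : step_on S (ker_plus V)) (stU : step_on S (ker_plus U)).

Let g a b : int := \dim (i @: ker_plus V a :&: ker_plus U b).

(** Inclusion-exclusion: the two subspaces summed in the denominator meet exactly in the
    intersection of the two smaller kernels. *)
Lemma block_functionE a b : 0 < a -> 0 < b ->
  (block_function i a b)%:Z =
    (g a b - g a (prev_jump S b)) -
    (g (prev_jump S a) b - g (prev_jump S a) (prev_jump S b)).
Proof.
move=> a0 b0; rewrite /block_function !(ker_minus_prev_jump (S := S))//.
set a' := prev_jump S a; set b' := prev_jump S b.
have Kaa' : (i @: ker_plus V a' <= i @: ker_plus V a)%VS.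
  by apply/limgS/ker_plusS; rewrite ?prev_jump_ge0// ltW// prev_jump_lt.
have Kbb' : (ker_plus U b' <= ker_plus U b)%VS.
  by apply/ker_plusS; rewrite ?prev_jump_ge0// ltW// prev_jump_lt.
rewrite /g; move: (i @: _)%VS (i @: _)%VS (ker_plus U b) (ker_plus U b') Kaa' Kbb'.
move=> K K' A A' KK' AA'; set W := (K' :&: A + K :&: A')%VS.
have WS : (W <= K :&: A)%VS by rewrite subv_add capvS// capvS.
have := dimv_cap_compl (K :&: A) W; rewrite (capv_idPr WS) => <-.
have := dimv_sum_cap (K' :&: A) (K :&: A').
have -> : (K' :&: A :&: (K :&: A') = K' :&: A')%VS.
  by rewrite capvA -(capvA K') (capvC A) capvA (capv_idPl KK') -capvA (capv_idPr AA').
move/(congr1 Posz); rewrite !PoszD -/W => WE.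
lia.
Qed.

(** The second differences telescope in [a]; the lower end vanishes because the kernel at 0 is
    zero. *)
Lemma sum_block_function b t : uniq S -> all (> 0) S -> all (<= t) S -> 0 <= t ->
  0 < b ->
  \sum_(a \in [set a : R | 0 < a]) (block_function i a b)%:Z =
    g t b - g t (prev_jump S b).
Proof.
move=> uS S0 St t0 b0; pose h a := g a b - g a (prev_jump S b).
have hS : step_on S h.
  by move=> r s r0 rs rsS; rewrite /h /g (stV r0 rs rsS).
have blockE a : 0 < a -> (block_function i a b)%:Z = h a - h (prev_jump S a).
  by move=> a0; rewrite block_functionE.
rewrite -(@bigfs _ _ _ _ S (fun a => 0 < a))//; last first.
  by move=> a a0 aS; rewrite blockE// (step_prev_jump hS)// subrr.
rewrite (eq_bigr (fun a => h a - h (prev_jump S a))); last by move=> a /blockE.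
rewrite -big_filter (all_filterP S0) -[X in \sum_(_ <- X) _](all_filterP St) big_filter.
rewrite telescope_step//.
by rewrite /h /g ker_plus0 limg0 !cap0v !dimv0 subrr subr0.
Qed.

End Telescoping.
End BlockFunction.

(** * Multiplicities on the infinity line as drops of component counts *)

Section MatchingMultiplicity.
Context {R : realType} {Z : finMetricType R}.
Implicit Types (M N X : {set Z}) (r s t b : R).

Definition near_components X r : {set {set Z}} :=
  [set C in pi0 [set: Z]%SET r | ~~ [disjoint C & X]]%SET.

(** These are the radii at which [VR] can change; leaving out pairs of equal points makes all of
    them positive. *)
Definition distances : seq R :=
  undup [seq mdist e.1 e.2 | e <- enum {: Z * Z} & e.1 != e.2].

Lemma distances_gt0 : all (> 0) distances.
Proof.
apply/allP => d; rewrite mem_undup => /mapP[e].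
by rewrite mem_filter => /andP[e12 _] ->; rewrite mdist_gt0.
Qed.

Lemma mdist_distances (u v : Z) : u != v -> mdist u v \in distances.
Proof.
move=> uv; rewrite mem_undup; apply/mapP; exists (u, v) => //=.
by rewrite mem_filter mem_enum /= uv.
Qed.

Lemma step_VR M : step_on distances (VR M).
Proof.
move=> r s r0 rs rsS; apply/funext => x; apply/funext => y; rewrite /VR /=.
have [->|xy] := eqVneq x y; first by rewrite !andbF.
do 2 congr andb; apply/idP/idP => [/le_trans|]; first exact.
exact/rsS/mdist_distances.
Qed.

Lemma step_pi0 M : step_on distances (pi0 M).
Proof. by move=> r s r0 rs /(step_VR M r0 rs); rewrite /pi0 => ->. Qed.

(** The target space depends on [s] as a type. This form mentions [s] only through the set
    [pi0 N s], which can be rewritten. *)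
Lemma mem_lker_H0_map M r N s (v : H0 M r) :
  (v \in lker (H0_map M r N s)) =
  [forall D in pi0 N s, \sum_(C : pi0_type M r | val C \subset D) v C == 0].
Proof.
rewrite memv_ker lfunE /=; apply/eqP/forall_inP => [/ffunP v0 D DN|v0].
  by have := v0 (Sub D DN); rewrite !ffunE => /eqP.
by apply/ffunP => D; rewrite !ffunE; exact/eqP/v0/valP.
Qed.

Lemma step_lker M r N : step_on distances (fun s => lker (H0_map M r N s)).
Proof.
move=> s t s0 st /(step_pi0 N s0 st) stE; apply/vspaceP => v.
by rewrite [LHS]mem_lker_H0_map [RHS]mem_lker_H0_map stE.
Qed.

Lemma pi0_complete M t : M != finset.set0 -> all (<= t) distances -> 0 <= t ->
  pi0 M t = [set M]%SET.
Proof.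
move=> /set0Pn[z zM] /allP St t0.
have conn x y : x \in M -> y \in M -> connect (VR M t) x y.
  have [->//|xy xM yM] := eqVneq x y.
  by apply: connect1; rewrite /VR /= xM yM xy; exact/St/mdist_distances.
have compE x : x \in M -> [set y in M | connect (VR M t) x y]%SET = M.
  by move=> xM; apply/setP => y; rewrite finset.inE; apply: andb_idr; exact: conn.
apply/setP => C; rewrite finset.in_set1; apply/imsetP/eqP => [[x xM ->]|->].
  exact: compE.
by exists z; rewrite // compE.
Qed.

(** Beyond all distances both target graphs are connected, so either kernel consists of the vectors
    with coordinate sum zero. *)
Lemma lker_complete M r t X : X != finset.set0 -> M \subset X ->
  all (<= t) distances -> 0 <= t ->
  lker (H0_map M r X t) = lker (H0_map M r [set: Z]%SET t).
Proof.
move=> X0 MX St t0; apply/vspaceP => v.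
rewrite [LHS]mem_lker_H0_map [RHS]mem_lker_H0_map.
have Z0 : [set: Z]%SET != finset.set0.
  by case/set0Pn: X0 => x _; apply/set0Pn; exists x; rewrite finset.in_setT.
have sumE (N : {set Z}) : M \subset N ->
    \sum_(C : pi0_type M r | val C \subset N) v C = \sum_C v C.
  move=> MN; apply: eq_bigl => C; apply: (fintype.subset_trans _ MN).
  have /and3P[/eqP covM _ _] := pi0_partition M r.
  have : val C \subset finset.cover (pi0 M r).
    exact: (finset.bigcup_sup (val C) (valP C)).
  by rewrite covM.
rewrite (pi0_complete X0 St t0) (pi0_complete Z0 St t0).
apply/forall_inP/forall_inP => v0 D.
  rewrite finset.in_set1 => /eqP ->; rewrite sumE ?finset.subsetT// -(sumE X)//.
  by apply: v0; rewrite finset.set11.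
rewrite finset.in_set1 => /eqP ->; rewrite sumE// -(sumE [set: Z]%SET) ?finset.subsetT//.
by apply: v0; rewrite finset.set11.
Qed.

Section Multiplicity.
Context (X : {set Z}) (mU : R -> nat).
Hypotheses (X0 : X != finset.set0)
  (mUP : has_multiplicities (PH0 [set: Z]%SET) mU).

Local Notation U := (PH0 [set: Z]%SET).
Local Notation near := (near_components X).

Lemma ker_dim_PH0 r : 0 <= r ->
  (ker_dim U r + #|pi0 [set: Z]%SET r|)%N = \dim {:H0 [set: Z]%SET (0 : R)}.
Proof.
move=> r0; rewrite -(limg_ker_dim (H0_map [set: Z]%SET 0 [set: Z]%SET r) fullv).
rewrite capfv rank_H0_map//; congr (_ + _)%N.
congr #|pred_of_set _|; apply/setP => C; rewrite finset.inE.
apply/esym/andb_idr => CN; have /set0Pn[x xC] := pi0_neq0 CN.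
by apply/pred0Pn; exists x; rewrite /= xC finset.in_setT.
Qed.

(** Rank-nullity for the structure map restricted to the image of [H0 X 0]. *)
Lemma dim_limg_capker r : 0 <= r ->
  (\dim (limg (H0_map X 0 [set: Z]%SET 0) :&: ker_plus U r) + #|near r|)%N =
  \dim (limg (H0_map X 0 [set: Z]%SET 0)).
Proof.
move=> r0; rewrite -[RHS](limg_ker_dim (H0_map [set: Z]%SET 0 [set: Z]%SET r)).
congr (_ + _)%N; rewrite -limg_comp H0_map_comp ?finset.subsetT//.
by rewrite rank_H0_map ?finset.subsetT.
Qed.

Lemma sum_induced_block b : 0 < b ->
  \sum_(a \in [set a : R | 0 < a]) (induced_block X a b)%:Z =
  #|near (prev_jump distances b)|%:Z - #|near b|%:Z.
Proof.
move=> b0; pose t := Num.max b (\big[Num.max/0]_(x <- distances) x).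
have bt : b <= t by rewrite le_max lexx.
have St : all (<= t) distances.
  by apply/allP => x xS; rewrite /= le_max le_bigmax_seq ?orbT.
have t0 : 0 <= t by exact: le_trans (ltW b0) bt.
(* A class of [X] that dies in [Z] by [r <= t] also dies in [X] by [t], where [X] has become
   connected; intersecting with the kernel of [X] at [t] therefore loses nothing. *)
have capE r : 0 <= r -> r <= t ->
    (H0_map X 0 [set: Z]%SET 0 @: ker_plus (PH0 X) t :&: ker_plus U r =
     limg (H0_map X 0 [set: Z]%SET 0) :&: ker_plus U r)%VS.
  move=> r0 rt; apply/eqP; rewrite eqEsubv capvS ?limgS ?subvf//=.
  rewrite subv_cap capvSr andbT; apply/subvP => _ /memv_capP[/memv_imgP[v _ ->] vU].
  apply: memv_img; rewrite /ker_plus /= lker_complete ?subxx//.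
  move: vU; rewrite !memv_ker /= -comp_lfunE H0_map_comp ?finset.subsetT// => vU.
  rewrite -(H0_map_comp (finset.subsetT X) r0 (subxx _) rt).
  by rewrite comp_lfunE (eqP vU) linear0.
have dimE r : 0 <= r -> r <= t ->
    (\dim (H0_map X 0 [set: Z]%SET 0 @: ker_plus (PH0 X) t :&: ker_plus U r))%:Z =
    (\dim (limg (H0_map X 0 [set: Z]%SET 0)))%:Z - #|near r|%:Z.
  by move=> r0 rt; rewrite (capE r r0 rt) -(dim_limg_capker r0) PoszD addrK.
have stX := @step_lker X 0 X; have stU := @step_lker [set: Z]%SET 0 [set: Z]%SET.
have b'0 := prev_jump_ge0 distances b.
have b't : prev_jump distances b <= t by exact/(le_trans _ bt)/ltW/prev_jump_lt.
apply: etrans (@sum_block_function _ _ (PH0 X) U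
  (H0_map X 0 [set: Z]%SET 0) distances stX stU b t (undup_uniq _) distances_gt0 St t0 b0) _.
apply: etrans (congr2 (fun x y : int => x - y)
  (dimE b (ltW b0) bt) (dimE _ b'0 b't)) _.
by rewrite opprB addrC addrA addrNK.
Qed.

(** [mU b] is the drop in the number of all components, and the block sum is the drop in the number
    of those meeting [X]. *)
Lemma matching_inftyE b : 0 < b -> matching_infty X mU b =
  #|far_components X (prev_jump distances b)|%:Z - #|far_components X b|%:Z.
Proof.
move=> b0; rewrite /matching_infty sum_induced_block//.
rewrite (multiplicity_jump mUP (@step_lker _ _ _) b0).
have := ker_dim_PH0 (ltW b0); have := ker_dim_PH0 (prev_jump_ge0 distances b).
have splitE r : #|pi0 [set: Z]%SET r| = (#|near r| + #|far_components X r|)%N.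
  rewrite -(cardsID [set C : {set Z} | [disjoint C & X]]%SET) addnC.
  congr (_ + _)%N; congr #|pred_of_set _|; apply/setP => C; rewrite !finset.inE//.
  exact: andbC.
rewrite !splitE; lia.
Qed.

End Multiplicity.

Lemma far_components_le X r s : r <= s ->
  (#|far_components X s| <= #|far_components X r|)%N.
Proof.
(* [up] sends a component at [r] to the one at [s] that contains it. It reaches every far component
   at [s], since the smaller components inside are far as well. *)
move=> rs; pose up (C : {set Z}) := oapp (component s) finset.set0 [pick x in C].
apply: (leq_trans _ (leq_imset_card up _)); apply: subset_leq_card.
apply/fintype.subsetP => D; rewrite finset.inE => /andP[/imsetP[x _ ->]].
have -> : [set y in [set: Z]%SET | connect (VR [set: Z]%SET s) x y]%SET = component s x.
  by apply/setP => y; rewrite !finset.inE.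
have sub : component r x \subset component s x.
  apply/fintype.subsetP => y; rewrite !finset.inE; apply: connect_sub => u v uv.
  exact/connect1/(VR_sub (subxx _) rs).
move=> farD; apply/imsetP; exists (component r x).
  by rewrite finset.inE component_pi0 (disjointWl sub).
rewrite /up; case: pickP => [y|/(_ x)]; last by rewrite finset.inE connect0.
move=> /(fintype.subsetP sub); rewrite !finset.inE /= => xy.
apply/setP => w; rewrite !finset.inE; apply: same_connect xy _.
exact: VR_connect_sym.
Qed.

End MatchingMultiplicity.

(** * Bounding the distance from a point to the subset *)

Section MatchingBound.
Context {R : realType} {Z : finMetricType R} (X : {set Z}) (mU : R -> nat).
Hypotheses (X0 : X != finset.set0)
  (mUP : has_multiplicities (PH0 [set: Z]%SET) mU).
Implicit Types (r b beta : R).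

Local Notation S := (@distances R Z).
Local Notation mD := (matching_infty X mU).
Local Notation far r := #|far_components X r|.

Lemma matching_infty_ge0 b : 0 < b -> 0 <= mD b.
Proof.
move=> b0; rewrite matching_inftyE// subr_ge0 lez_nat.
exact/far_components_le/ltW/prev_jump_lt.
Qed.

Lemma step_far : step_on S (fun r => far r).
Proof. by move=> r s r0 rs /(step_pi0 _ r0 rs) E; rewrite /far_components E. Qed.

Lemma matching_infty_eq0 b : 0 < b -> b \notin S -> mD b = 0.
Proof.
by move=> b0 bS; rewrite matching_inftyE// (step_prev_jump step_far)// subrr.
Qed.

Lemma far_complete t : all (<= t) S -> 0 <= t -> far t = 0%N.
Proof.
move=> St t0; apply/eqP; rewrite finset.cards_eq0 -finset.subset0.
apply/fintype.subsetP => C.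
have [x xX] := set0Pn _ X0.
rewrite !finset.inE pi0_complete//; last first.
  by apply/set0Pn; exists x; rewrite finset.in_setT.
rewrite finset.in_set1 => /andP[/eqP -> /pred0P/(_ x)].
by rewrite /= finset.in_setT xX.
Qed.

Lemma sum_matching_infty r : 0 <= r -> \sum_(b <- S | r < b) mD b = (far r)%:Z.
Proof.
move=> r0; pose t := \big[Num.max/0]_(x <- S) x.
have St : all (<= t) S by apply/allP => x xS; exact: le_bigmax_seq.
have t0 : 0 <= t by exact: bigmax_ge_id.
have uS : uniq S by exact: undup_uniq.
(* The sign turns the drops of [far] into the increments that [telescope_step] sums. *)
pose h r : int := - (far r)%:Z.
have hS : step_on S h by move=> u v u0 uv uvS; rewrite /h (step_far u0 uv uvS).
have mDE (P : pred R) : \sum_(b <- S | P b) mD b =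
    \sum_(b <- S | P b) (h b - h (prev_jump S b)).
  rewrite big_seq_cond [RHS]big_seq_cond; apply: eq_bigr => b /andP[bS _].
  have b0 : 0 < b := allP distances_gt0 b bS.
  by rewrite matching_inftyE// /h opprK addrC.
have tot := telescope_step uS distances_gt0 hS t0.
have low := telescope_step uS distances_gt0 hS r0.
have : \sum_(b <- S | b <= t) (h b - h (prev_jump S b)) =
    \sum_(b <- S | b <= r) (h b - h (prev_jump S b)) + \sum_(b <- S | r < b) mD b.
  rewrite mDE -big_filter (all_filterP St) (bigID (fun b => b <= r)) /=.
  by congr (_ + _); apply: eq_bigl => b; rewrite ltNge.
rewrite tot low /h far_complete//; lia.
Qed.

(** The number of far components at [eta_f] is the sum of the multiplicities beyond it, which are
    nonnegative and, by maximality, not positive. *)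
Lemma far_eta : far_components X (eta_f X mU) = finset.set0.
Proof.
pose A := [set b : R | b = 0 \/ (0 < b /\ 0 < mD b)].
(* Boundedness is what makes [sup] an actual upper bound of [A]. *)
have A_ub b : A b -> b <= \big[Num.max/0]_(x <- S) x.
  move=> [->|[b0 mDb]]; first exact: bigmax_ge_id.
  apply: le_bigmax_seq => //; apply/negPn/negP => bS.
  by rewrite matching_infty_eq0 ?ltxx in mDb.
have A_sup : has_sup A.
  by split; [exists 0; left|exists (\big[Num.max/0]_(x <- S) x) => b /A_ub].
have eta0 : 0 <= eta_f X mU by apply: sup_upper_bound => //; left.
apply: finset.cards0_eq; apply/eqP; rewrite -eqz_nat -sum_matching_infty//.
rewrite big1_seq// => b /andP[eta_b bS].
have b0 : 0 < b by exact: le_lt_trans eta_b.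
apply/eqP; rewrite eq_le matching_infty_ge0// andbT leNgt; apply/negP => mDb.
have : b <= eta_f X mU by apply: sup_upper_bound => //; right.
by rewrite leNgt eta_b.
Qed.

(* The right-hand side is the integral over [r >= 0] of the function equal to
   [c_f] for [r < beta] and to [far r] for [r >= beta], which bounds the number
   of edges longer than [r] in a cheapest path from [z] to [X]. *)
Lemma dist_point_set_le beta z : 0 <= beta ->
  dist_point_set z X <= (c_f X mU)%:R * beta +
    \sum_(b <- S | beta <= b) (mD b)%:~R * (b - beta).
Proof.
move=> beta0; have [p opt] := exists_cheapest z X0.
have dist_le : dist_point_set z X <= \sum_(d <- pairmap mdist z p) d.
  apply: le_trans (mdist_path z p); apply: inf_lbound; last first.
    by exists (last z p) => //; case: opt.
  by exists 0 => _ [y _ <-]; exact: mdist_ge0.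
apply: (le_trans dist_le).
(* Each edge is at most [beta] plus its excess over [beta]; the two contributions are bounded
   separately. *)
pose ex d := Num.max (d - beta) 0.
(* Listing each [b - beta] with its multiplicity prepares for [ler_sum_count]. *)
have -> : \sum_(b <- S | beta <= b) (mD b)%:~R * (b - beta) =
  \sum_(x <- flatten [seq nseq `|mD b|%N (b - beta) | b <- S & beta <= b]) x.
  rewrite big_flatten big_map big_filter big_seq_cond [RHS]big_seq_cond.
  apply: eq_bigr => b /andP[bS _].
  rewrite big_nseq iter_addr_0 -mulr_natl -[in LHS](gez0_abs (matching_infty_ge0 _)) //.
  exact: (allP distances_gt0 b bS).
apply: (@le_trans _ _ ((size p)%:R * beta + \sum_(x <- map ex (pairmap mdist z p)) x)).
  rewrite big_map -(size_pairmap mdist z p).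
  elim: (pairmap _ _ _) => [|d s IH]; first by rewrite !big_nil mul0r addr0.
  rewrite !big_cons /= mulrS mulrDl mul1r addrACA lerD//.
  by rewrite /ex -lerBlDl le_max lexx.
rewrite lerD//.
  by rewrite ler_wpM2r// ler_nat (cheapest_size opt far_eta).
apply: ler_sum_count.
- by apply/allP => _ /mapP[d _ ->]; rewrite /ex le_max lexx orbT.
- apply/allP => x /flattenP[_ /mapP[b + ->]].
  rewrite mem_filter => /andP[bb _] /nseqP[-> _].
  by rewrite subr_ge0.
move=> r r0; rewrite count_map count_flatten -map_comp.
(* An excess above [r] is an edge longer than [r + beta]. There are at most [far (r + beta)] of
   these, which is the total multiplicity beyond [r + beta]. *)
rewrite (eq_count (a2 := > (r + beta))); last first.
  by move=> d /=; rewrite /ex lt_max (ltNge r 0) r0 orbF ltrBrDr.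
apply: (leq_trans (cheapest_long_edges _ opt)).
have -> : far (r + beta) = (\sum_(b <- S | (r + beta < b)%R) `|mD b|)%N.
  apply/eqP; rewrite -eqz_nat -sum_matching_infty ?addr_ge0//; apply/eqP.
  rewrite (big_morph Posz PoszD (erefl _)) big_seq_cond [RHS]big_seq_cond.
  apply: eq_bigr => b /andP[bS _]; rewrite gez0_abs// matching_infty_ge0//.
  exact: (allP distances_gt0 b bS).
rewrite sumnE big_map big_filter big_mkcond [leqRHS]big_mkcond /=.
apply: leq_sum => b _; case: ifPn => // rb.
rewrite (le_trans _ (ltW rb)) ?lerDr// count_nseq /= ltrBrDr rb.
by rewrite mul1n.
Qed.

End MatchingBound.

(** * The bound on the Hausdorff distance *)

Lemma fsbig_distances (R : realType) (Z : finMetricType R) (G : zmodType)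
    (g : R -> G) (beta : R) :
  (forall b, beta <= b -> b \notin @distances R Z -> g b = 0) ->
  \sum_(b \in [set b : R | beta <= b]) g b =
    \sum_(b <- @distances R Z | beta <= b) g b.
Proof.
move=> g0; rewrite -(@bigfs _ _ _ _ (@distances R Z) (fun b => beta <= b))//.
exact: undup_uniq.
Qed.

Theorem proposition3p6 (R : realType) (Z : finMetricType R) (X : {set Z})
    (mU : R -> nat) (HX : X != finset.set0)
    (HmU : has_multiplicities (PH0 [set: Z]%SET) mU)
    (Heta : eta_f X mU != 0) :
  dist_hausdorff X [set: Z]%SET <=
    \sum_(b \in [set b : R | b_f X mU <= b])
       ((matching_infty X mU b)%:~R * b)
    - (r_f X mU)%:~R * b_f X mU.
Proof.
have beta0 : 0 <= b_f X mU.
  rewrite /b_f; set A := (X in sup X).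
  (* Without a supremum, [sup] takes its default value 0. *)
  have [A_sup|noA] := pselect (has_sup A); last by rewrite sup_out.
  have [[b Ab] _] := A_sup; have [b0 _] := Ab.
  exact: le_trans (ltW b0) (sup_upper_bound A_sup Ab).
set beta := b_f X mU in beta0 *.
set rhs := (X in _ <= X).
(* Expanding [r_f] puts the claimed bound into the integrated form of [dist_point_set_le]. *)
have rhsE : rhs = (c_f X mU)%:R * beta + \sum_(b <- @distances R Z | beta <= b)
    (matching_infty X mU b)%:~R * (b - beta).
  under [in RHS]eq_bigr do rewrite mulrBr.
  rewrite sumrB -mulr_suml -rmorph_sum /= addrCA; congr (_ + _).
    apply: fsbig_distances => b beta_b bS.
    (* [matching_infty_eq0] needs [b] positive; at [b = 0] the factor [b] vanishes. *)
    have [->|b_neq0] := eqVneq b 0; first by rewrite mulr0.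
    have b0 : 0 < b by rewrite lt_neqAle eq_sym b_neq0 (le_trans beta0).
    by rewrite (matching_infty_eq0 HX HmU)// mul0r.
  (* If [beta = 0], the common factor [beta] makes both sides zero; otherwise every index is
     positive. *)
  rewrite -mulrBl -mulNr; have [->|beta_gt0] := eqVneq beta 0; first by rewrite !mulr0.
  congr (_ * _); rewrite /r_f -/beta.
  rewrite (@fsbig_distances R Z).
    by rewrite intrB opprB.
  move=> b beta_b bS; apply: (matching_infty_eq0 HX HmU) => //.
  by apply: lt_le_trans beta_b; rewrite lt_neqAle eq_sym beta_gt0.
have rhs_ub z : dist_point_set z X <= rhs by rewrite rhsE; exact: dist_point_set_le.
have [x xX] := set0Pn _ HX.
have dist_ge0 z (A : {set Z}) : A != finset.set0 -> 0 <= dist_point_set z A.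
  case/set0Pn => a aA; apply: lb_le_inf; first by exists (mdist z a); exists a.
  by move=> _ [y _ <-]; exact: mdist_ge0.
(* Points of [X] are at distance 0 from [Z], so the first supremum is harmless; [rhs_ub] bounds the
   second. *)
rewrite ge_max; apply/andP; split; apply: ge_sup.
- by exists (dist_point_set x [set: Z]%SET); exists x.
- move=> _ [a aX <-]; apply: (@le_trans _ _ 0).
    apply: inf_lbound; first by exists 0 => _ [y _ <-]; exact: mdist_ge0.
    by exists a; rewrite /= ?finset.in_setT// mdistxx.
  exact: le_trans (dist_ge0 x X HX) (rhs_ub x).
- by exists (dist_point_set x X); exists x; rewrite /= ?finset.in_setT.
- by move=> _ [z _ <-].
Qed.
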